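(* Let $I\subseteq\mathbb{R}$ be an interval and let $f:I\to\mathbb{R}$ be such that $f'':I\to\mathbb{R}$ is an absolutely continuous function on the interior $I^{\circ}$ and $f'''\in L[a,b]$, where $a,b\in I$, $a<b$. Let $q\geq 1$. If $|f'''|^{q}$ belongs to $Q(I)$, then $$\left|\int_{a}^{b}f(x)\,dx-\frac{b-a}{6}\left[f(a)+4f\left(\frac{a+b}{2}\right)+f(b)\right]\right|$$ $$\leq \frac{(b-a)^{4}}{6}\left(\frac{1}{192}\right)^{1-\frac{1}{q}}\left\{\left(\frac{|f'''(a)|^{q}}{48}+\left(\frac{17}{48}-\frac{1}{2}\ln 2\right)|f'''(b)|^{q}\right)^{\frac{1}{q}}+\left(\left(\frac{17}{48}-\frac{1}{2}\ln 2\right)|f'''(a)|^{q}+\frac{|f'''(b)|^{q}}{48}\right)^{\frac{1}{q}}\right\}.$$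
   Context: Godunova-Levin class: a map $g:I\to\mathbb{R}$ is said to belong to the class $Q(I)$ if it is nonnegative and for all $x,y\in I$ and $\lambda\in(0,1)$ it satisfies $g(\lambda x+(1-\lambda)y)\leq \frac{g(x)}{\lambda}+\frac{g(y)}{1-\lambda}$. $L[a,b]$ denotes the space of Lebesgue integrable functions on $[a,b]$. *)

(* Defs.v *)
From HB Require Import structures.
From mathcomp Require Import all_boot all_order all_algebra.
From mathcomp Require Import all_classical all_reals all_analysis.

Set Implicit Arguments.
Unset Strict Implicit.
Unset Printing Implicit Defensive.

Import Order.TTheory GRing.Theory Num.Theory.
Import numFieldNormedType.Exports.

Local Open Scope classical_set_scope.
Local Open Scope ring_scope.

(* A function on a set [I] of reals is represented by a total function [R -> R],
   of which the predicates below only inspect the values on the given set. *)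

(* The derivative at [x] of [f] as a function on [I]: the two-sided derivative
   at interior points of an interval [I], the one-sided one at its endpoints.
   MathComp-Analysis' [is_derive] would depend on values of [f] outside [I]. *)
Definition is_derive_in (R : realType) (I : set R) (f : R -> R) (x df : R) :
    Prop :=
  (f y - f x) / (y - x) @[y --> within I x^'] --> df.

Definition absolutely_continuous_on (R : realType) (A : set R) (F : R -> R) :
    Prop :=
  forall e : R, 0 < e -> exists2 d : R, 0 < d &
    forall (n : nat) (u v : 'I_n -> R),
      (forall i, [/\ A (u i), A (v i) & u i < v i]) ->
      trivIset setT (fun i => `]u i, v i[%classic) ->
      \sum_(i < n) (v i - u i) < d ->
      \sum_(i < n) `|F (v i) - F (u i)| < e.

(* The Godunova-Levin class Q(I). *)
Definition godunova_levin (R : realType) (I : set R) (g : R -> R) : Prop :=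
  (forall x, I x -> 0 <= g x) /\
  (forall x y l : R, I x -> I y -> 0 < l < 1 ->
    g (l * x + (1 - l) * y) <= g x / l + g y / (1 - l)).

(* Main.v *)
Require Import Defs.
From mathcomp Require Import all_boot all_order all_algebra.
From mathcomp Require Import all_classical all_reals all_analysis.
From mathcomp Require Import ring lra.

(* With [L = (b - a) / 2] and [m = (a + b) / 2], the error of Simpson's rule is
   the sum of two terms: the integral over [a, m] of [u^2 (L - u) / 6] times
   [f'''(a + u)], and minus its mirror image at [b].  The first is equal to
   [int_a^m f - L/3 (f a + 2 f m) + L^2/6 f' m], which is nonnegative when
   [f''] is nondecreasing, by the trapezoid inequality for the convex [f'].
   Thus if [|f'''| <= h] and [h = G'''], then [G'' + f''] and [G'' - f''] are
   nondecreasing and the error term of [f] is at most the one of [G].  The class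
   Q gives [|f'''(x)|^q <= v], [v = D A / (b - x) + D B / (x - a)], [D = b - a],
   [A = |f'''(a)|^q], [B = |f'''(b)|^q].  Instead of Hölder's inequality, bound
   the concave function [v |-> v^(1/q)] by its tangent at the weighted mean of
   [v]: then [h = al v + be] has elementary primitives, and the error term of
   [G] is exactly the claimed bound. *)

Import Order.TTheory GRing.Theory Num.Theory.
Import numFieldNormedType.Exports.

Local Open Scope classical_set_scope.
Local Open Scope ring_scope.

Set Implicit Arguments.
Unset Strict Implicit.
Unset Printing Implicit Defensive.

(** * Derivatives and continuity of explicit expressions, stated on lambda terms so that they
    compose *)

Section calculus.
Context {R : realType}.
Implicit Types (f g : R -> R) (x a b m : R).

Lemma is_derive_ext f g x df dg :
  is_derive x (1 : R) f df -> f =1 g -> df = dg -> is_derive x (1 : R) g dg.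
Proof. by move=> h /funext <- <-. Qed.

Lemma is_derive_add f g x df dg : is_derive x (1 : R) f df ->
  is_derive x (1 : R) g dg ->
  is_derive x (1 : R) (fun y => f y + g y) (df + dg).
Proof. by move=> hf hg; apply: (is_derive_ext (is_deriveD hf hg)). Qed.

Lemma is_derive_scale f x df k : is_derive x (1 : R) f df ->
  is_derive x (1 : R) (fun y => k * f y) (k * df).
Proof. by move=> hf; apply: (is_derive_ext (is_deriveZ k hf)). Qed.

Lemma is_derive_mul f g x df dg : is_derive x (1 : R) f df ->
  is_derive x (1 : R) g dg ->
  is_derive x (1 : R) (fun y => f y * g y) (df * g x + f x * dg).
Proof.
move=> hf hg; apply: (is_derive_ext (is_deriveM hf hg)) => //.
by rewrite /GRing.scale /=; ring.
Qed.

Lemma is_derive_const x c : is_derive x (1 : R) (fun=> c) (0 : R).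
Proof. exact: (is_derive_cst c x 1). Qed.

Lemma is_derive_affine x k c : is_derive x (1 : R) (fun y => k * y + c) k.
Proof.
apply: (is_derive_ext (is_derive_add 
  (is_derive_scale k (is_derive_id (x : R) (1 : R)))
  (is_derive_const x c))) => //.
by rewrite mulr1 addr0.
Qed.

Lemma is_derive_comp_affine f x k c df : is_derive (k * x + c) (1 : R) f df ->
  is_derive x (1 : R) (fun y => f (k * y + c)) (k * df).
Proof.
move=> hf; have hg := is_derive_affine x k c.
apply: (is_derive_ext (is_derive1_comp (g := fun y => k * y + c) hf hg)) => //.
by rewrite mulrC.
Qed.

Lemma is_derive_continuous f x df :
  is_derive x (1 : R) f df -> {for x, continuous f}.
Proof.
by move=> [h _]; apply/differentiable_continuous/derivable1_diffP.
Qed.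

Lemma within_continuous_add (A : set R) f g : {within A, continuous f} ->
  {within A, continuous g} -> {within A, continuous (fun x => f x + g x)}.
Proof. by move=> cf cg x; exact: (continuousD (cf x) (cg x)). Qed.

Lemma within_continuous_mul (A : set R) f g : {within A, continuous f} ->
  {within A, continuous g} -> {within A, continuous (fun x => f x * g x)}.
Proof. by move=> cf cg x; exact: (continuousM (cf x) (cg x)). Qed.

Lemma within_continuous_const (A : set R) (c : R) :
  {within A, continuous (fun=> c)}.
Proof. by move=> x; exact: cst_continuous. Qed.

(** By the mean value theorem. The endpoints only need continuity, which leaves room for logarithmic
    singularities there. *)
Lemma is_derive_ge0_le f (df : R -> R) a m : a <= m ->
  (forall x, a < x < m -> is_derive x (1 : R) f (df x)) ->
  (forall x, a < x < m -> 0 <= df x) ->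
  {within `[a, m], continuous f} -> f a <= f m.
Proof.
rewrite le_eqVlt => /predU1P[->//|am] hd hge cf.
have hd' x : x \in `]a, m[%R -> is_derive x 1 f (df x).
  by rewrite in_itv /=; exact: hd.
have [c cam e] := MVT am hd' cf.
rewrite -subr_ge0 e; apply: mulr_ge0; last by rewrite subr_ge0 ltW.
by rewrite in_itv /= in cam; exact: hge.
Qed.
End calculus.

(** * Sign of the error functional on half an interval *)

Section simpson_half.
Context {R : realType}.
Implicit Types (w : R -> R) (a m : R).

Lemma derivable_within_itvcc w (dw : R -> R) a m :
  (forall x, a <= x <= m -> is_derive x (1 : R) w (dw x)) ->
  {within `[a, m], continuous w}.
Proof.
move=> hd; apply: derivable_within_continuous => x.
by rewrite in_itv /= => /hd[].
Qed.

(** Here [w1] is convex with primitive [w]. As a function of the left endpoint [x], the integral of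
    [w1] over [[x, m]] minus its trapezoid sum is nondecreasing and vanishes at [m]. *)
Lemma trapezoid_convex_le w w1 w2 a m : a <= m ->
  (forall x, a <= x <= m -> is_derive x (1 : R) w (w1 x)) ->
  (forall x, a <= x <= m -> is_derive x (1 : R) w1 (w2 x)) ->
  (forall x y, a <= x -> x <= y -> y <= m -> w2 x <= w2 y) ->
  w m - w a <= (m - a) / 2 * (w1 a + w1 m).
Proof.
move=> am hw hw1 mono.
pose psi x := (w m + (-1) * w x) +
  ((2^-1 * x + (- (m / 2))) * (1 * w1 x + w1 m)).
have hpsi x : a <= x <= m -> is_derive x (1 : R) psi
    ((0 + (-1) * w1 x) + (2^-1 * (1 * w1 x + w1 m) +
       (2^-1 * x + (- (m / 2))) * (1 * w2 x + 0))).
  move=> xam; apply: (is_derive_add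
    (is_derive_add (is_derive_const _ _) (is_derive_scale (-1) (hw x xam)))
    (is_derive_mul (is_derive_affine _ _ _) (is_derive_add
      (is_derive_scale 1 (hw1 x xam)) (is_derive_const _ _)))).
suff : psi a <= psi m by rewrite /psi; nra.
have sub x : a < x < m -> a <= x <= m by move=> /andP[/ltW -> /ltW ->].
apply: (is_derive_ge0_le am (fun x h => hpsi x (sub x h))).
- move=> x /andP[ax xm].
  have hxm y : x <= y <= m -> is_derive y (1 : R) w1 (w2 y).
    by move=> /andP[xy ym]; apply: hw1; rewrite ym (le_trans (ltW ax) xy).
  have hxm' y : y \in `]x, m[ -> is_derive y (1 : R) w1 (w2 y).
    by rewrite in_itv /= => /andP[/ltW xy /ltW ym]; apply: hxm; rewrite xy.
  (* [psi' x] is half of [(w1 m - w1 x) - (m - x) * w2 x], and [w1 m - w1 x = w2 c * (m - x)] with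
     [w2 c >= w2 x]. *)
  have [c] := MVT xm hxm' (derivable_within_itvcc hxm).
  rewrite in_itv /= => /andP[xc cm] e.
  have := mono x c (ltW ax) (ltW xc) (ltW cm).
  by nra.
- exact: derivable_within_itvcc hpsi.
Qed.

(** Letting the left endpoint vary gives, up to sign, a function [phi] that vanishes at [m]; its
    derivative at [x] is two thirds of the trapezoid defect on [[x, m]]. At [a] only [W] and [w]
    have to be continuous, since [w2] will contain [ln (x - a)]. *)
Lemma simpson_half_ge0 (W w w1 w2 : R -> R) a m : a < m ->
  (forall x, a < x <= m -> is_derive x (1 : R) W (w x)) ->
  (forall x, a < x <= m -> is_derive x (1 : R) w (w1 x)) ->
  (forall x, a < x <= m -> is_derive x (1 : R) w1 (w2 x)) ->
  (forall x y, a < x -> x <= y -> y <= m -> w2 x <= w2 y) ->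
  {within `[a, m], continuous W} -> {within `[a, m], continuous w} ->
  0 <= W m - W a - (m - a) / 3 * (w a + 2 * w m) + (m - a) ^+ 2 / 6 * w1 m.
Proof.
move=> am hW hw hw1 mono cW cw.
pose l := fun x : R => 1 * x + (- m).
pose phi x := (W x + (- W m)) +
  ((3^-1 * x + (- (m / 3))) * ((-1) * w x + (- 2 * w m)))
  + (- (w1 m / 6)) * (l x * l x).
have hphi x : a < x < m -> is_derive x (1 : R) phi
    ((w x + 0) + (3^-1 * ((-1) * w x + (- 2 * w m)) +
       (3^-1 * x + (- (m / 3))) * ((-1) * w1 x + 0)) +
     (- (w1 m / 6)) * (1 * l x + l x * 1)).
  move=> /andP[ax xm]; have xam : a < x <= m by rewrite ax ltW.
  exact: (is_derive_add (is_derive_add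
    (is_derive_add (hW x xam) (is_derive_const _ _))
    (is_derive_mul (is_derive_affine _ _ _) (is_derive_add
      (is_derive_scale (-1) (hw x xam)) (is_derive_const _ _))))
    (is_derive_scale _ (is_derive_mul (is_derive_affine _ _ _)
      (is_derive_affine _ _ _)))).
suff : phi a <= phi m by rewrite /phi /l; lra.
apply: (is_derive_ge0_le (ltW am) hphi).
- move=> x /andP[ax xm].
  have /(_ _ _) := @trapezoid_convex_le w w1 w2 x m (ltW xm).
  have sub y : x <= y <= m -> a < y <= m by move=> /andP[/(lt_le_trans ax) -> ->].
  move=> /(_ (fun y h => hw y (sub y h)) (fun y h => hw1 y (sub y h))).
  move=> /(_ (fun y z h => mono y z (lt_le_trans ax h))).
  by rewrite /l; lra.
- have caff k c : {within `[a, m], continuous (fun x : R => k * x + c)}.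
    apply: derivable_within_itvcc => x _; exact: is_derive_affine.
  have cst c := @within_continuous_const _ `[a, m] c.
  exact: (within_continuous_add (within_continuous_add
    (within_continuous_add cW (cst _))
    (within_continuous_mul (caff _ _) (within_continuous_add
      (within_continuous_mul (cst _) cw) (cst _))))
    (within_continuous_mul (cst _) (within_continuous_mul (caff _ _) (caff _ _)))).
Qed.
End simpson_half.

(** * Powers times logarithms: derivatives, and continuity up to zero *)

Section log_comparison.
Context {R : realType}.
Implicit Types (a b c d k m u x : R).

Lemma is_derive_expn_ln n c d u : 0 < u ->
  is_derive u (1 : R) (fun x => x ^+ n.+1 * (c * ln x + d))
    (u ^+ n * (n.+1%:R * c * ln u + (c + n.+1%:R * d))).
Proof.
move=> u0.
have hln : is_derive u (1 : R) (fun x => c * ln x + d) (c * u^-1 + 0).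
  exact: (is_derive_add (is_derive_scale c (is_derive1_ln u0))
    (is_derive_const _ _)).
have hX : is_derive u (1 : R) (fun x => x ^+ n.+1) (n.+1%:R * u ^+ n).
  have := is_deriveX n.+1 (is_derive_id (u : R) (1 : R)).
  rewrite exprfctE /GRing.scale /= mulr1; exact.
apply: (is_derive_ext (is_derive_mul hX hln)) => //.
by rewrite exprS; field; rewrite gt_eqF.
Qed.

Lemma mul_ln_le1 u : `|u| <= 1 -> `|u * ln u| <= 1.
Proof.
have [u0 _|u0] := leP u 0; first by rewrite ln0 // mulr0 normr0.
rewrite gtr0_norm // => u1; rewrite ler_norml; apply/andP; split; last first.
  by rewrite (le_trans _ ler01) // mulr_ge0_le0 ?ln_le0 // ltW.
have uV : 0 < u^-1 by rewrite invr_gt0.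
(* Multiplied by [u], this gives [- (u * ln u) <= 1 - u]. *)
have h : ln u^-1 <= u^-1 - 1.
  have := @le_ln1Dx _ (u^-1 - 1); rewrite addrCA subrr addr0; apply.
  by lra.
have : u * ln u^-1 <= u * (u^-1 - 1) by rewrite ler_pM2l.
by rewrite mulrBr divff ?gt_eqF // mulr1 lnV ?posrE // mulrN; lra.
Qed.

(** At zero, one factor [x] keeps [x * ln x] bounded and the remaining [x ^+ n.+1] tends to zero.
    Continuity there is two-sided because [ln] is zero on nonpositive reals. *)
Lemma continuous_expn_ln n c d u : 0 <= u ->
  {for u, continuous (fun x => x ^+ n.+2 * (c * ln x + d))}.
Proof.
rewrite le_eqVlt => /predU1P[<-|u0]; last first.
  exact: is_derive_continuous (is_derive_expn_ln n.+1 c d u0).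
pose M := `|c| + `|d| + 1.
have M0 : 0 < M by rewrite ltr_pwDr // addr_ge0.
rewrite /prop_for /continuous_at /= expr0n mul0r.
apply/cvgr0Pnorm_le => e e0.
near=> x.
have x1 : `|x| <= 1.
  by near: x; exact: cvgr0_norm_le (@cvg_id _ _) _ ltr01.
have xe : `|x| <= e / M.
  by near: x; apply: cvgr0_norm_le (@cvg_id _ _) _ _; rewrite divr_gt0.
have -> : x ^+ n.+2 * (c * ln x + d) = x ^+ n.+1 * (c * (x * ln x) + x * d).
  by rewrite exprS; ring.
rewrite normrM normrX exprS.
have hX : `|x| * `|x| ^+ n <= e / M.
  rewrite (le_trans _ xe) // ler_piMr // exprn_ile1 //.
have hM : `|c * (x * ln x) + x * d| <= M.
  rewrite (le_trans (ler_normD _ _)) // !normrM /M -normrM.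
  have := mul_ln_le1 x1; have := normr_ge0 c; have := normr_ge0 d.
  by have := normr_ge0 x; nra.
by rewrite -[leRHS](divfK (lt0r_neq0 M0)) ler_pM // mulr_ge0 ?exprn_ge0.
Unshelve. all: by end_near. Qed.
End log_comparison.

(** * Comparison of the half error with that of an explicit function *)

Section simpson_half_le.
Context {R : realType}.

(** A family containing the iterated primitives of [ln]: the pairs [(1, -1)], [(1/2, -3/4)],
    [(1/6, -11/36)] for [n] equal to 1, 2, 3. *)
Definition logp (n : nat) (c d x : R) : R := x ^+ n * (c * ln x + d).

Lemma is_derive_logp n c d c' d' (k e x : R) : 0 < k * x + e ->
  c' = n.+1%:R * c -> d' = c + n.+1%:R * d ->
  is_derive x (1 : R) (fun y => logp n.+1 c d (k * y + e))
    (k * logp n c' d' (k * x + e)).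
Proof.
by move=> h -> ->; apply: is_derive_comp_affine; exact: is_derive_expn_ln.
Qed.

Lemma within_continuous_logp n (c d k e a m : R) :
  (forall x, a <= x <= m -> 0 <= k * x + e) ->
  {within `[a, m], continuous (fun y => logp n.+2 c d (k * y + e))}.
Proof.
move=> h; apply: continuous_in_subspaceT => x; rewrite inE /= in_itv /= => xam.
have haff : {for x, continuous (fun y : R => k * y + e)}.
  exact: is_derive_continuous (is_derive_affine x k e).
exact: (@continuous_comp _ _ _ (fun y : R => k * y + e) (logp n.+2 c d) x
  haff (continuous_expn_ln (h x xam))).
Qed.

Lemma is_derive_expn_div n (x : R) : 
  is_derive x (1 : R) (fun y => y ^+ n.+1 / n.+1`!%:R) (x ^+ n / n`!%:R).
Proof.
have := is_derive_scale (n.+1`!%:R^-1)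
  (is_deriveX n.+1 (is_derive_id (x : R) (1 : R))).
move=> h; apply: (is_derive_ext h) => [y|].
  by rewrite mulrC exprfctE.
rewrite /GRing.scale /= [X in _ * X]mulr1 factS natrM; field.
by rewrite nat1r !pnatr_eq0 -lt0n fact_gt0.
Qed.

(** The right-hand side is the exact functional of [G] with
    [G''' = c1 / (x - a) + c2 / (b - x) + c0]. The hypothesis on increments says that [G'' + k * f2]
    is nondecreasing, so the functional of [G + k * F] is nonnegative. *)
Lemma simpson_half_le (F f f1 f2 : R -> R) (k a b m c0 c1 c2 : R) : a < m ->
  b = 2 * m - a ->
  (forall x, a < x <= m -> is_derive x (1 : R) F (f x)) ->
  (forall x, a < x <= m -> is_derive x (1 : R) f (f1 x)) ->
  (forall x, a < x <= m -> is_derive x (1 : R) f1 (f2 x)) ->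
  {within `[a, m], continuous F} -> {within `[a, m], continuous f} ->
  (forall x y, a < x -> x <= y -> y <= m -> k * (f2 x - f2 y) <=
    (c1 * ln (y - a) - c2 * ln (b - y) + c0 * y) -
    (c1 * ln (x - a) - c2 * ln (b - x) + c0 * x)) ->
  - (k * (F m - F a - (m - a) / 3 * (f a + 2 * f m) + (m - a) ^+ 2 / 6 * f1 m))
  <= c1 * (m - a) ^+ 3 / 36 + c2 * (m - a) ^+ 3 * (17 / 36 - 2 / 3 * ln 2)
     + c0 * (m - a) ^+ 4 / 72.
Proof.
move=> am bE hF hf hf1 cF cf mono.
(* [W] is [G + k * F]; [w], [w1], [w2] are its successive derivatives, each bringing a factor [-1]
   out of the terms in [b - x]. *)
pose W x := c1 * logp 3 (1/6) (- 11 / 36) (1 * x + - a)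
  + c2 * logp 3 (1/6) (- 11 / 36) (-1 * x + b)
  + c0 * (x ^+ 4 / 4`!%:R) + k * F x.
pose w x := c1 * (1 * logp 2 (1/2) (- 3 / 4) (1 * x + - a))
  + c2 * (-1 * logp 2 (1/2) (- 3 / 4) (-1 * x + b))
  + c0 * (x ^+ 3 / 3`!%:R) + k * f x.
pose w1 x := c1 * (1 * (1 * logp 1 1 (-1) (1 * x + - a)))
  + c2 * (-1 * (-1 * logp 1 1 (-1) (-1 * x + b)))
  + c0 * (x ^+ 2 / 2`!%:R) + k * f1 x.
pose w2 x := c1 * (1 * (1 * (1 * logp 0 1 0 (1 * x + - a))))
  + c2 * (-1 * (-1 * (-1 * logp 0 1 0 (-1 * x + b))))
  + c0 * (x ^+ 1 / 1`!%:R) + k * f2 x.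
have d3 (i j x : R) : 0 < i * x + j -> is_derive x (1 : R)
    (fun y => logp 3 (1/6) (- 11 / 36) (i * y + j))
    (i * logp 2 (1/2) (- 3 / 4) (i * x + j)).
  by move=> h; apply: is_derive_logp => //; field.
have d2 (i j x : R) : 0 < i * x + j -> is_derive x (1 : R)
    (fun y => logp 2 (1/2) (- 3 / 4) (i * y + j))
    (i * logp 1 1 (-1) (i * x + j)).
  by move=> h; apply: is_derive_logp => //; field.
have d1 (i j x : R) : 0 < i * x + j -> is_derive x (1 : R)
    (fun y => logp 1 1 (-1) (i * y + j)) (i * logp 0 1 0 (i * x + j)).
  by move=> h; apply: is_derive_logp => //; ring.
have ua x : a < x <= m -> 0 < 1 * x + - a by lra.
have ub x : a < x <= m -> 0 < -1 * x + b by lra.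
have hW x : a < x <= m -> is_derive x (1 : R) W (w x).
  move=> xam; exact: (is_derive_add (is_derive_add (is_derive_add
    (is_derive_scale _ (d3 _ _ _ (ua x xam)))
    (is_derive_scale _ (d3 _ _ _ (ub x xam))))
    (is_derive_scale _ (is_derive_expn_div 3 x)))
    (is_derive_scale _ (hF x xam))).
have hw x : a < x <= m -> is_derive x (1 : R) w (w1 x).
  move=> xam; exact: (is_derive_add (is_derive_add (is_derive_add
    (is_derive_scale _ (is_derive_scale _ (d2 _ _ _ (ua x xam))))
    (is_derive_scale _ (is_derive_scale _ (d2 _ _ _ (ub x xam)))))
    (is_derive_scale _ (is_derive_expn_div 2 x)))
    (is_derive_scale _ (hf x xam))).
have hw1 x : a < x <= m -> is_derive x (1 : R) w1 (w2 x).
  move=> xam; exact: (is_derive_add (is_derive_add (is_derive_add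
    (is_derive_scale _ (is_derive_scale _
      (is_derive_scale _ (d1 _ _ _ (ua x xam)))))
    (is_derive_scale _ (is_derive_scale _
      (is_derive_scale _ (d1 _ _ _ (ub x xam))))))
    (is_derive_scale _ (is_derive_expn_div 1 x)))
    (is_derive_scale _ (hf1 x xam))).
have mono2 x y : a < x -> x <= y -> y <= m -> w2 x <= w2 y.
  move=> ax xy ym; have := mono x y ax xy ym.
  by rewrite /w2 /logp !expr0 !expr1 factS fact0 muln1 !mul1r !mulN1r
    !(addrC (- _) b) !divr1; lra.
have cst c := @within_continuous_const _ `[a, m] c.
have ua' x : a <= x <= m -> 0 <= 1 * x + - a by lra.
have ub' x : a <= x <= m -> 0 <= -1 * x + b by lra.
have cX n : {within `[a, m], continuous (fun x : R => x ^+ n.+1 / n.+1`!%:R)}.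
  exact: (derivable_within_itvcc (fun x _ => is_derive_expn_div n x)).
have cW : {within `[a, m], continuous W}.
  exact: (within_continuous_add (within_continuous_add (within_continuous_add
    (within_continuous_mul (cst _) (within_continuous_logp ua'))
    (within_continuous_mul (cst _) (within_continuous_logp ub')))
    (within_continuous_mul (cst _) (cX 3)))
    (within_continuous_mul (cst _) cF)).
have cw : {within `[a, m], continuous w}.
  exact: (within_continuous_add (within_continuous_add (within_continuous_add
    (within_continuous_mul (cst _) (within_continuous_mul (cst _)
      (within_continuous_logp ua')))
    (within_continuous_mul (cst _) (within_continuous_mul (cst _)
      (within_continuous_logp ub'))))
    (within_continuous_mul (cst _) (cX 2)))
    (within_continuous_mul (cst _) cf)).
have := simpson_half_ge0 am hW hw hw1 mono2 cW cw.
pose l := m - a.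
have l0 : 0 < l by rewrite subr_gt0.
have lm : ln (-1 * m + b) = ln l by congr ln; rewrite /l; lra.
(* [b - a] is twice [l]: this is the origin of [ln 2] in the bound. *)
have lb : ln (-1 * a + b) = ln 2 + ln l.
  by rewrite -lnM ?posrE //; congr ln; rewrite /l bE; ring.
rewrite /W /w /w1 /logp lm lb.
have -> : 1 * m + - a = l by rewrite mul1r.
rewrite -/l => H; rewrite -subr_ge0; apply: (le_trans H).
rewrite le_eqVlt; apply/orP; left; apply/eqP.
have ma : m = l + a by rewrite subrK.
(* Logarithms and function values become atoms for [field]. The default value [ln 0] at [x = a] is
   harmless: its factor is a positive power of zero. *)
move: (F m) (F a) (f m) (f a) (f1 m) (ln 2) (ln l) (ln (1 * a - a)).
clearbody l; rewrite bE ma !factS fact0 => Fm Fa fm fa f1m ln2 lnl lna.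
by rewrite !mul1r subrr; field.
Qed.
End simpson_half_le.

(** * Local slopes, small open covers of null sets, and induction along an interval *)

Section absolute_continuity.
Context {R : realType}.
Local Notation mu := (@lebesgue_measure R).

(** The division-free form includes [y = x] and adds up well over adjacent intervals. *)
Lemma is_derive_slopeP (f : R -> R) (x df : R) :
  is_derive x (1 : R) f df <->
  (forall e : R, 0 < e -> exists2 r : R, 0 < r &
    forall y, `|y - x| < r -> `|f y - f x - df * (y - x)| <= e * `|y - x|).
Proof.
have key : is_derive x (1 : R) f df <->
    h^-1 *: ((f \o shift x) (h *: (1 : R)) - f x) @[h --> 0^'] --> df.
  split=> [[dfx <-]|h]; first exact: dfx.
  by split; [apply/cvg_ex; exists df|exact/cvg_lim].
split.
- move=> /key /cvgrPdist_le h e e0.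
  have [r /= r0 hr] := h e e0; exists r => // y yr.
  have [->|yx] := eqVneq y x; first by rewrite !subrr mulr0 subrr !normr0 mulr0.
  have yx0 : y - x != 0 by rewrite subr_eq0.
  have := hr (y - x); rewrite /ball_ /= sub0r normrN => /(_ yr yx0).
  rewrite /GRing.scale /= mulr1 subrK => hd.
  rewrite -ler_pdivrMr ?normr_gt0 // -normf_div distrC in hd *.
  rewrite (_ : _ / _ = (y - x)^-1 * (f y - f x) - df) //.
  by field.
- move=> h; apply/key/cvgrPdist_le => e e0.
  have [r r0 hr] := h e e0; exists r => // k /=.
  rewrite /ball_ /= sub0r normrN => kr k0.
  have := hr (k + x); rewrite addrK => /(_ kr).
  rewrite /GRing.scale /= mulr1 -ler_pdivrMr ?normr_gt0 // -normf_div distrC.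
  rewrite (_ : _ / _ = k^-1 * (f (k + x) - f x) - df) //.
  by field.
Qed.

Lemma is_derive_in_interior (I : set R) (f : R -> R) (x df : R) :
  nbhs x I -> is_derive_in I f x df -> is_derive x (1 : R) f df.
Proof.
move=> [s /= s0 sI] /cvgrPdist_le h; apply/is_derive_slopeP => e e0.
have [r /= r0 hr] := h e e0.
exists (Num.min r s) => [|y]; first by rewrite lt_min r0.
rewrite lt_min => /andP[yr ys].
have [->|yx] := eqVneq y x; first by rewrite !subrr mulr0 subrr !normr0 mulr0.
have yx0 : y - x != 0 by rewrite subr_eq0.
have := hr y; rewrite /ball_ /= distrC => /(_ yr yx).
have Iy : I y by apply: sI; rewrite /ball_ /= distrC.
move=> /(_ Iy) hd.
rewrite -ler_pdivrMr ?normr_gt0 // -normf_div distrC in hd *.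
rewrite (_ : _ / _ = (f y - f x) / (y - x) - df) //.
by field.
Qed.

(** Outer regularity, applied to a measurable null set containing [N]. *)
Lemma negligible_open_cover (N : set R) (e : R) : mu.-negligible N -> 0 < e ->
  exists U : set R, [/\ open U, N `<=` U & (mu U < e%:E)%E].
Proof.
move=> [A [mA A0 NA]] e0.
have Aoo : (mu A < +oo)%E by rewrite A0.
have [U [oU AU hU']] := lebesgue_regularity_outer mA Aoo e0.
have hU : (mu (U `\` A) < e%:E)%E := hU'.
exists U; split => //; first exact: subset_trans AU.
have mU := measurable_realfun.open_measurable oU.
rewrite -(setDUK AU); apply: le_lt_trans hU.
have -> : mu (U `\` A) = (mu A + mu (U `\` A))%E by rewrite A0 add0e.
by apply: measureU2 => //; exact: measurableD.
Qed.

Lemma sum_length_le n (u v : 'I_n -> R) (U : set R) (e : R) : open U ->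
  (mu U < e%:E)%E ->
  (forall i, u i < v i /\ `]u i, v i[ `<=` U) ->
  trivIset setT (fun i => `]u i, v i[%classic) ->
  \sum_(i < n) (v i - u i) < e.
Proof.
move=> oU Ue huv tr; rewrite -lte_fin (le_lt_trans _ Ue) //.
pose V := \big[setU/set0]_(i < n) `]u i, v i[%classic.
have mV : measurable V.
  by apply: bigsetU_measurable => i _; exact: measurable_itv.
have <- : mu V = (\sum_(i < n) (v i - u i))%:E.
  rewrite [LHS]measure_bigsetU_ord // -sumEFin; apply: eq_bigr => i _.
  by rewrite [LHS]lebesgue_measure_itv /= lte_fin (huv i).1.
apply: le_measure; rewrite ?inE //.
  exact: measurable_realfun.open_measurable.
apply: (big_ind (fun A => A `<=` U)); first exact: sub0set.
  by move=> A B AU BU x [/AU|/BU].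
by move=> i _; exact: (huv i).2.
Qed.

(** Take the supremum [z] of the points of [[c, d]] satisfying [P]: the left-hand step gives [P z],
    and the right-hand step would pass beyond [z] if [z < d]. *)
Lemma real_induction (P : R -> Prop) (c d : R) : c <= d -> P c ->
  (forall z, c <= z <= d -> exists2 r : R, 0 < r &
    (forall x, c <= x -> z - r < x < z -> P x -> P z) /\
    (forall y, y <= d -> z < y < z + r -> P z -> P y)) ->
  P d.
Proof.
move=> cd Pc step.
pose S := [set x | c <= x <= d /\ P x].
have Sc : S c by split; rewrite // lexx cd.
have Sd : ubound S d by move=> x [/andP[]].
have hS : has_sup S by split; [exists c|exists d].
pose z := sup S.
have cz : c <= z by apply: (sup_upper_bound hS).
have zd : z <= d by apply: sup_le_ub => //; exists c.
have [|r r0 [hl hr]] := step z; first by rewrite cz.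
have [x [/andP[cx xd] Px] zx] := sup_adherent r0 hS.
have Pz : P z.
  have : x <= z by apply: (sup_upper_bound hS); split; rewrite ?cx.
  rewrite le_eqVlt => /predU1P[<- //|xz].
  by apply: (hl x) => //; rewrite xz andbT.
move: zd; rewrite le_eqVlt => /predU1P[<- //|zd].
pose y := Num.min d (z + r / 2).
have zy : z < y by rewrite lt_min zd ltrDl divr_gt0.
have yd : y <= d by rewrite ge_min lexx.
have yzr : y < z + r.
  by rewrite (@le_lt_trans _ _ (z + r / 2)) ?ge_min ?lexx ?orbT //; lra.
have Py : P y by apply: hr => //; rewrite zy.
have : y <= z.
  by apply: (sup_upper_bound hS); split; rewrite // yd (le_trans cz (ltW zy)).
by rewrite leNgt zy.
Qed.

End absolute_continuity.

(** * Increments of an absolutely continuous function from an almost everywhere bound on its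
    derivative *)

Section increment.
Context {R : realType}.
Local Notation mu := (@lebesgue_measure R).

(* Cousin's argument: [c, d] is cut into intervals on which either the bound on
   the derivative controls the increment of [F], up to [e] times the length, or
   which lie in an open set of small measure covering the exceptional null set;
   absolute continuity bounds the total increment over the latter. *)
Lemma absolutely_continuous_increment_le (F H f h : R -> R) (a b : R) :
  absolutely_continuous_on `]a, b[ F ->
  (forall x, a < x < b -> is_derive x (1 : R) H (h x)) ->
  {ae mu, forall x, a < x < b -> is_derive x (1 : R) F (f x)} ->
  (forall x, a < x < b -> `|f x| <= h x) ->
  forall c d, a < c -> c <= d -> d < b -> `|F d - F c| <= H d - H c.
Proof.
move=> acF hH hF fh c d ac cd db.
have Hmono x y : a < x -> x <= y -> y < b -> H x <= H y.
  move=> ax xy yb.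
  have hd z : x <= z <= y -> is_derive z (1 : R) H (h z).
    by move=> /andP[xz zy]; apply: hH;
      rewrite (lt_le_trans ax xz) (le_lt_trans zy yb).
  apply: (is_derive_ge0_le xy) => [z /andP[/ltW xz /ltW zy]|z /andP[xz zy]|].
  - by apply: hd; rewrite xz.
  - apply: le_trans (fh z _); first exact: normr_ge0.
    by rewrite (lt_trans ax xz) (lt_trans zy yb).
  - exact: derivable_within_itvcc hd.
apply/ler_addgt0Pr => e' e'0.
(* The total error is [e * (d - c)] from good intervals plus [e] from those inside [U], which is
   [e']. *)
pose e := e' / (d - c + 1).
have dc1 : 0 < d - c + 1 by lra.
have e0 : 0 < e by rewrite divr_gt0.
have [dl dl0 hdl] := acF e e0.
have [U [oU NU Udl]] := negligible_open_cover hF dl0.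
(* Up to [x], the increment is controlled by that of [H], a linear error, and the increments of [F]
   over an ordered finite list of intervals inside [U]. *)
pose P x := exists n (u v : nat -> R),
  [/\ forall i, (i < n)%N ->
        [/\ c <= u i, u i < v i, v i <= x & `]u i, v i[ `<=` U],
      forall i j, (i < j < n)%N -> v i <= u j &
      `|F x - F c| <= H x - H c + e * (x - c) +
        \sum_(i < n) `|F (v i) - F (u i)|].
suff [n [u [v [huv hdisj hle]]]] : P d.
  suff : \sum_(i < n) `|F (v i) - F (u i)| < e.
    have : e * (d - c + 1) = e' by rewrite /e divfK // lt0r_neq0.
    by rewrite mulrDr mulr1; lra.
  have tr : trivIset setT (fun i : 'I_n => `]u i, v i[%classic).
    apply/trivIsetP => i j _ _ ij.
    wlog ltij : i j ij / (i < j)%N.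
      move=> wl; move: (ij); rewrite neq_ltn => /orP[|] ?; first exact: wl.
      by rewrite setIC; apply: wl; rewrite // eq_sym.
    apply/seteqP; split=> // x /=; rewrite !in_itv /= => -[/andP[_ xv] /andP[ux _]].
    have := hdisj i j; rewrite ltij ltn_ord => /(_ isT) vu.
    by have := lt_trans (lt_le_trans xv vu) ux; rewrite ltxx.
  apply: hdl => //.
    move=> i; have [cu uv vd _] := huv i (ltn_ord i).
    by split; rewrite //= in_itv /=; apply/andP; split; lra.
  apply: (@sum_length_le _ n (fun i => u i) (fun i => v i) U dl oU Udl) => //.
  by move=> i; have [] := huv i (ltn_ord i).
(* Extending from [x] to [y] either enlarges the first two terms or appends []x, y[] to the list; in
   the latter case they do not decrease, as [H] is monotone. *)
have link x y : c <= x -> x < y -> y <= d -> P x ->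
    `|F y - F x| <= H y - H x + e * (y - x) \/ `]x, y[ `<=` U -> P y.
  move=> cx xy yd [n [u [v [huv hdisj hle]]]].
  have tri : `|F y - F c| <= `|F y - F x| + `|F x - F c|.
    by rewrite (le_trans _ (ler_normD _ _)) // addrA subrK.
  case=> [hxy|xyU].
    exists n, u, v; split=> //.
      by move=> i /huv[? ? vx ?]; split=> //; rewrite (le_trans vx (ltW xy)).
    by move: hxy hle tri; rewrite !mulrBr; lra.
  exists n.+1, (fun i => if i == n then x else u i),
    (fun i => if i == n then y else v i); split.
  - move=> i; rewrite ltnS leq_eqVlt; case: eqP => [_ _|_ /= /huv[? ? vx ?]].
      by split.
    by split=> //; rewrite (le_trans vx (ltW xy)).
  - move=> i j /andP[ij]; rewrite ltnS leq_eqVlt; case: (eqVneq j n) => [jn _|jn /= jn'].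
      rewrite (ltn_eqF (_ : i < n)%N) -?jn //.
      by have [] := huv i; rewrite -?jn.
    by rewrite (ltn_eqF (ltn_trans ij jn')); apply: hdisj; rewrite ij.
  - rewrite big_ord_recr /= eqxx.
    under eq_bigr => i _ do rewrite (ltn_eqF (ltn_ord i)).
    have := Hmono x y (lt_le_trans ac cx) (ltW xy) (le_lt_trans yd db).
    have : e * (x - c) <= e * (y - c) by rewrite ler_pM2l // lerB // ltW.
    by move: hle tri; lra.
apply: (real_induction cd).
  exists 0%N, (fun=> 0), (fun=> 0); split=> //.
  by rewrite !subrr normr0 mulr0 big_ord0 !addr0.
move=> z /andP[cz zd].
have azb : a < z < b by rewrite (lt_le_trans ac cz) (le_lt_trans zd db).
have [Uz|Uz] := pselect (U z).
  have [r /= r0 hr] : nbhs z U by exact: open_nbhs_nbhs.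
  exists r => //; split.
    move=> x cx /andP[zx xz] Px; apply: (link x z cx xz zd Px); right.
    move=> t /=; rewrite in_itv /= => /andP[xt tz]; apply: hr.
    by rewrite /ball_ /= gtr0_norm ?subr_gt0 //; lra.
  move=> y yd /andP[zy yr] Pz; apply: (link z y cz zy yd Pz); right.
  move=> t /=; rewrite in_itv /= => /andP[zt ty]; apply: hr.
  by rewrite /ball_ /= ltr0_norm ?subr_lt0 //; lra.
have dF : is_derive z (1 : R) F (f z).
  by apply: contrapT => nF; apply/Uz/NU => /= /(_ azb).
(* Outside [U] both derivatives exist at [z]; half of [e] goes to the slope error of [F], half to
   that of [H]. *)
have e20 : 0 < e / 2 by rewrite divr_gt0.
have [r1 r10 h1] := (is_derive_slopeP F z (f z)).1 dF _ e20.
have [r2 r20 h2] := (is_derive_slopeP H z (h z)).1 (hH z azb) _ e20.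
have fhz := fh z azb.
exists (Num.min r1 r2); first by rewrite lt_min r10.
have mr1 : Num.min r1 r2 <= r1 by rewrite ge_min lexx.
have mr2 : Num.min r1 r2 <= r2 by rewrite ge_min lexx orbT.
split.
  move=> x cx /andP[zx xz] Px; apply: (link x z cx xz zd Px); left.
  have xzE : `|x - z| = z - x by rewrite ltr0_norm ?subr_lt0 // opprB.
  have := h1 x; have := h2 x; rewrite xzE => /(_ ltac:(lra)) k2 /(_ ltac:(lra)) k1.
  have l : `|f z * (x - z)| <= h z * (z - x).
    by rewrite normrM xzE ler_pM2r // subr_gt0.
  rewrite distrC.
  have t : `|F x - F z| <= `|F x - F z - f z * (x - z)| + `|f z * (x - z)|.
    by rewrite (le_trans _ (ler_normD _ _)) // subrK.
  by move: k2 t k1 l; rewrite ler_norml => /andP[? ?]; nra.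
move=> x xd /andP[zx xz] Px; apply: (link z x cz zx xd Px); left.
have xzE : `|x - z| = x - z by rewrite gtr0_norm ?subr_gt0.
have := h1 x; have := h2 x; rewrite xzE => /(_ ltac:(lra)) k2 /(_ ltac:(lra)) k1.
have l : `|f z * (x - z)| <= h z * (x - z).
  by rewrite normrM xzE ler_pM2r // subr_gt0.
have t : `|F x - F z| <= `|F x - F z - f z * (x - z)| + `|f z * (x - z)|.
  by rewrite (le_trans _ (ler_normD _ _)) // subrK.
by move: k2 t k1 l; rewrite ler_norml => /andP[? ?]; nra.
Qed.
End increment.

(** * Tangent bound for powers, and the estimate on half an interval *)

Section power_mean.
Context {R : realType}.

(** Makes the weight [17 / 48 - 1 / 2 * ln 2] positive. Five squarings of
    [1 + 17 / 768 <= expR (17 / 768)], rounded down each time, exceed 2. *)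
Lemma ln2_lt : ln 2 < 17 / 24 :> R.
Proof.
rewrite -ltr_expR lnK ?posrE //.
have -> : 17 / 24 = 32%:R * (17 / 768) :> R by field.
rewrite expRM_natl.
have h1 : (10221 / 10000) <= expR (17 / 768) :> R.
  by apply: le_trans (expR_ge1Dx _); lra.
have sq (x y z : R) : 0 <= x -> x <= y -> z <= x ^+ 2 -> z <= y ^+ 2.
  by move=> x0 xy /le_trans; apply; rewrite ler_pXn2r // nnegrE (le_trans x0).
have h2 : (10446 / 10000) <= expR (17 / 768) ^+ 2 :> R by apply: sq h1 _; lra.
have h4 : (10911 / 10000) <= expR (17 / 768) ^+ 4 :> R.
  by rewrite (exprM _ 2 2); apply: sq h2 _; lra.
have h8 : (11904 / 10000) <= expR (17 / 768) ^+ 8 :> R.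
  by rewrite (exprM _ 4 2); apply: sq h4 _; lra.
have h16 : (1417 / 1000) <= expR (17 / 768) ^+ 16 :> R.
  by rewrite (exprM _ 8 2); apply: sq h8 _; lra.
by rewrite (exprM _ 16 2); apply: lt_le_trans (sq _ _ (2007 / 1000) _ h16 _); lra.
Qed.

Lemma powR_tangent (t M K : R) : 0 < t <= 1 -> 0 <= M -> 0 < K ->
  exists al be : R, al * M + be * K = K `^ (1 - t) * M `^ t /\
    forall v, 0 <= v -> (M = 0 -> v = 0) -> v `^ t <= al * v + be.
Proof.
move=> /andP[t0 t1]; rewrite le_eqVlt => /predU1P[<-|M0] K0.
  exists 0, 0; split; first by rewrite !mul0r powR0 ?gt_eqF // addr0 mulr0.
  by move=> v _ /(_ erefl) ->; rewrite powR0 ?gt_eqF // mul0r addr0.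
pose y := ln M - ln K.
exists (t * expR ((t - 1) * y)), ((1 - t) * expR (t * y)); split.
  rewrite /powR !gt_eqF // -expRD.
  have -> : t * expR ((t - 1) * y) * M = t * expR ((1 - t) * ln K + t * ln M).
    by rewrite -mulrA -{1}[M]lnK ?posrE // -expRD; congr (_ * expR _);
      rewrite /y; ring.
  have -> : (1 - t) * expR (t * y) * K = (1 - t) * expR ((1 - t) * ln K + t * ln M).
    by rewrite -mulrA -{1}[K]lnK ?posrE // -expRD; congr (_ * expR _);
      rewrite /y; ring.
  by ring.
move=> v; rewrite le_eqVlt => /predU1P[<- _|v0 _].
  rewrite powR0 ?gt_eqF // mulr0 add0r mulr_ge0 ?expR_ge0 //; lra.
rewrite /powR gt_eqF //; set x := ln v.
(* [1 + z <= expR z] at [z = (1 - t) (x - y)] and at [z = - t (x - y)], with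
   weights [t] and [1 - t]. *)
have -> : t * expR ((t - 1) * y) * v =
    t * (expR (t * x) * expR ((1 - t) * (x - y))).
  rewrite -mulrA -{1}[v]lnK ?posrE // -!expRD -/x.
  by congr (_ * expR _); ring.
have -> : (1 - t) * expR (t * y) =
    (1 - t) * (expR (t * x) * expR (- t * (x - y))).
  by rewrite -expRD; congr (_ * expR _); ring.
have := expR_ge1Dx ((1 - t) * (x - y)); have := expR_ge1Dx (- t * (x - y)).
set p := expR _; set r := expR _ => hp hr.
have e0 := expR_gt0 (t * x).
have -> : t * (expR (t * x) * r) + (1 - t) * (expR (t * x) * p) =
  expR (t * x) * (t * r + (1 - t) * p) by ring.
rewrite ler_peMr ?expR_ge0 //.
have : 0 <= 1 - t by lra.
by nra.
Qed.

(** The increment hypothesis is granted for every affine majorant of the power, so that the tangent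
    can be chosen here: [M] and [1 / 192] are the integrals of [v] and of [1] against the kernel, up
    to the common factor [(b - a) ^+ 4 / 6]. *)
Lemma simpson_half_powR_le (F f f1 f2 : R -> R) (a b m A B q : R) : a < b ->
  m = (a + b) / 2 -> 1 <= q -> 0 <= A -> 0 <= B ->
  (forall x, a < x <= m -> is_derive x (1 : R) F (f x)) ->
  (forall x, a < x <= m -> is_derive x (1 : R) f (f1 x)) ->
  (forall x, a < x <= m -> is_derive x (1 : R) f1 (f2 x)) ->
  {within `[a, m], continuous F} -> {within `[a, m], continuous f} ->
  (forall al be : R,
    (forall r s, 0 <= r -> 0 <= s ->
      (r * A + s * B) `^ (1 / q) <= al * (r * A + s * B) + be) ->
    forall x y, a < x -> x <= y -> y <= m -> `|f2 y - f2 x| <=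
      (al * B * (b - a) * ln (y - a) - al * A * (b - a) * ln (b - y) + be * y) -
      (al * B * (b - a) * ln (x - a) - al * A * (b - a) * ln (b - x) + be * x)) ->
  `|F m - F a - (m - a) / 3 * (f a + 2 * f m) + (m - a) ^+ 2 / 6 * f1 m| <=
  (b - a) ^+ 4 / 6 * (1 / 192) `^ (1 - 1 / q) *
    ((17 / 48 - 1 / 2 * ln 2) * A + B / 48) `^ (1 / q).
Proof.
move=> ab mE q1 A0 B0 hF hf hf1 cF cf cmp.
have am : a < m by rewrite mE; lra.
have bE : b = 2 * m - a by rewrite mE; field.
set kap := 17 / 48 - 1 / 2 * ln 2; set M := kap * A + B / 48.
have kap0 : 0 < kap by have := ln2_lt; rewrite /kap; lra.
have M0 : 0 <= M by rewrite addr_ge0 ?divr_ge0 // mulr_ge0 // ltW.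
have q0 : 0 < q by lra.
have t01 : 0 < 1 / q <= 1.
  by rewrite divr_gt0 //= ler_pdivrMr // mul1r.
have [al [be [albe tan]]] := @powR_tangent (1 / q) M (1 / 192) t01 M0 ltac:(lra).
have {}cmp : forall x y, a < x -> x <= y -> y <= m -> `|f2 y - f2 x| <=
    (al * B * (b - a) * ln (y - a) - al * A * (b - a) * ln (b - y) + be * y) -
    (al * B * (b - a) * ln (x - a) - al * A * (b - a) * ln (b - x) + be * x).
  apply: cmp => r s r0 s0; apply: tan => [|MM].
    by rewrite addr_ge0 // mulr_ge0.
  (* Both weights in [M] are positive, so [M = 0] forces [A = B = 0]. *)
  have AA : A = 0 by move: MM; rewrite /M; nra.
  have BB : B = 0 by move: MM; rewrite /M AA; lra.
  by rewrite AA BB !mulr0 addr0.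
have bnd (k : R) : (k = 1 \/ k = -1) ->
    - (k * (F m - F a - (m - a) / 3 * (f a + 2 * f m) + (m - a) ^+ 2 / 6 * f1 m))
    <= (b - a) ^+ 4 / 6 * (al * M + be * (1 / 192)).
  move=> k1.
  have mono x y : a < x -> x <= y -> y <= m -> k * (f2 x - f2 y) <=
    (al * B * (b - a) * ln (y - a) - al * A * (b - a) * ln (b - y) + be * y) -
    (al * B * (b - a) * ln (x - a) - al * A * (b - a) * ln (b - x) + be * x).
    move=> ax xy ym; apply: le_trans (cmp x y ax xy ym).
    by rewrite distrC; case: k1 => ->; rewrite ?mul1r ?mulN1r ?ler_norm //
      -normrN ler_norm.
  apply: le_trans (simpson_half_le am bE hF hf hf1 cF cf mono) _.
  rewrite le_eqVlt; apply/orP; left; apply/eqP.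
  by rewrite /M /kap mE; field.
rewrite -[leRHS]mulrA -albe ler_norml.
have := bnd 1 (or_introl erefl); have := bnd (-1) (or_intror erefl).
by rewrite mulN1r opprK mul1r => ? ?; apply/andP; split; lra.
Qed.
End power_mean.

(** * Continuity from relative derivatives, and reflection about the origin *)

Section reflection.
Context {R : realType}.

(** Near [x] the difference quotients are at most [|df| + 1] in absolute value. *)
Lemma is_derive_in_continuous (I : set R) (f : R -> R) (x df : R) : I x ->
  is_derive_in I f x df -> f y @[y --> within I (nbhs x)] --> f x.
Proof.
move=> Ix /cvgrPdist_le h; apply/cvgrPdist_le => e e0.
have [r /= r0 hr] := h 1 ltr01.
pose M := `|df| + 1.
have M0 : 0 < M by rewrite ltr_pwDr.
exists (Num.min r (e / M)) => [|y /=].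
  by rewrite /= lt_min r0 divr_gt0.
rewrite /ball_ /= lt_min => /andP[yr ye] Iy.
have [->|yx] := eqVneq y x; first by rewrite subrr normr0 ltW.
have := hr y yr yx Iy => /= hd.
have yx0 : y - x != 0 by rewrite subr_eq0.
have le : `|(f y - f x) / (y - x)| <= M.
  rewrite -[X in `|X|](subrK df) (le_trans (ler_normD _ _)) //.
  by rewrite distrC /M addrC lerD2l.
rewrite normf_div ler_pdivrMr ?normr_gt0 // in le.
rewrite distrC (le_trans le) //.
by rewrite -ler_pdivlMl // mulrC distrC ltW.
Qed.

Lemma within_continuous_opp (f : R -> R) (a b : R) : a < b ->
  {within `[a, b], continuous f} ->
  {within `[- b, - a], continuous (fun x => f (- x))}.
Proof.
move=> ab; have ba : - b < - a by rewrite ltrN2.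
move=> /(continuous_within_itvP _ ab) [cf fa fb].
apply/(continuous_within_itvP _ ba); split.
- move=> x; rewrite in_itv /= => /andP[bx xa].
  apply: (@continuous_comp _ _ _ -%R f); first exact: opp_continuous.
  by apply: cf; rewrite in_itv /= ltrNr xa ltrNl bx.
- by rewrite opprK; apply/cvg_at_leftNP.
- by rewrite opprK; apply/cvg_at_rightNP.
Qed.
End reflection.

(** The weight [(b - x) / (b - a)] represents [x] as a convex combination of [a] and [b]. *)
Lemma godunova_levin_le (R : realType) (I : set R) (g : R -> R) (a b x : R) :
  godunova_levin I g -> I a -> I b -> a < x < b ->
  g x <= (b - a) / (b - x) * g a + (b - a) / (x - a) * g b.
Proof.
move=> [_ hQ] Ia Ib /andP[ax xb].
have ba : 0 < b - a by lra.
have l01 : 0 < (b - x) / (b - a) < 1.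
  apply/andP; split; first by apply: divr_gt0 => //; lra.
  by rewrite ltr_pdivrMr // mul1r; lra.
have := hQ a b _ Ia Ib l01.
rewrite (_ : _ * a + _ = x); last by field; lra.
rewrite (_ : _ + _ / (1 - _) =
  (b - a) / (b - x) * g a + (b - a) / (x - a) * g b) //.
by field; lra.
Qed.

(** * The integral as the increment of a primitive *)

Section primitive.
Context {R : realType}.
Local Notation mu := (@lebesgue_measure R).

Lemma continuous_primitive (f : R -> R) (a b : R) : a < b ->
  {within `[a, b], continuous f} ->
  exists F : R -> R,
    [/\ {within `[a, b], continuous F},
      (forall x, a < x < b -> is_derive x (1 : R) F (f x)) &
      \int[mu]_(x in `[a, b]) f x = F b - F a].
Proof.
move=> ab cf.
have fint : mu.-integrable `[a, b] (EFin \o f).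
  by apply: continuous_compact_integrable => //; exact: segment_compact.
exists (fun x => parameterized_integral mu a x f); split.
- exact: parameterized_integral_continuous (ltW ab) fint.
- move=> x /andP[ax xb].
  have xab : x \in `]a, b[ by rewrite in_itv /= ax.
  have [h <-] := continuous_FTC1_closed xb fint ax
    (within_continuous_continuous ab cf xab).
  by rewrite derive1E; exact/derivableP.
- by rewrite /parameterized_integral set_itv1 Rintegral_set1 subr0.
Qed.
End primitive.

Theorem theorem6 (R : realType) (I : set R) (f f1 f2 f3 : R -> R) (a b q : R)
  (hI : is_interval I)
  (hf1 : forall x, I x -> is_derive_in I f x (f1 x))
  (hf2 : forall x, I x -> is_derive_in I f1 x (f2 x))
  (hac : absolutely_continuous_on (interior I) f2)
  (hf3 : {ae (@lebesgue_measure R), forall x, I x -> is_derive_in I f2 x (f3 x)})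
  (ha : I a) (hb : I b) (hab : a < b)
  (hint : (@lebesgue_measure R).-integrable `[a, b] (EFin \o f3))
  (hq : 1 <= q)
  (hQ : godunova_levin I (fun x => `|f3 x| `^ q)) :
  `| \int[@lebesgue_measure R]_(x in `[a, b]) f x
     - (b - a) / 6 * (f a + 4 * f ((a + b) / 2) + f b) |
  <= (b - a) ^+ 4 / 6 * (1 / 192) `^ (1 - 1 / q) *
     ((`|f3 a| `^ q / 48 + (17 / 48 - 1 / 2 * ln 2) * `|f3 b| `^ q) `^ (1 / q)
      + ((17 / 48 - 1 / 2 * ln 2) * `|f3 a| `^ q + `|f3 b| `^ q / 48) `^ (1 / q)).
Proof.
have abI x : a <= x <= b -> I x by exact: hI.
have oI : `]a, b[ `<=` interior I.
  rewrite -open_subsetE; last exact: itv_open.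
  by move=> x /=; rewrite in_itv /= => /andP[/ltW ax /ltW xb]; apply: abI; rewrite ax.
have nI x : a < x < b -> nbhs x I by move=> xab; apply: oI; rewrite /= in_itv.
have df x : a < x < b -> is_derive x (1 : R) f (f1 x).
  by move=> xab; apply: is_derive_in_interior (nI x xab)
    (hf1 x (nbhs_singleton (nI x xab))).
have df1 x : a < x < b -> is_derive x (1 : R) f1 (f2 x).
  by move=> xab; apply: is_derive_in_interior (nI x xab)
    (hf2 x (nbhs_singleton (nI x xab))).
have df2 : {ae (@lebesgue_measure R),
    forall x, a < x < b -> is_derive x (1 : R) f2 (f3 x)}.
  apply: negligibleS hf3 => x /= nh h; apply: nh => xab.
  exact: is_derive_in_interior (nI x xab) (h (nbhs_singleton (nI x xab))).
have acf2 : absolutely_continuous_on `]a, b[ f2.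
  move=> e /hac[d d0 hd]; exists d => // n u v huv; apply: hd => i.
  by have [? ? ?] := huv i; split=> //; exact: oI.
have cf : {within `[a, b], continuous f}.
  apply/subspace_continuousP => x /= xab.
  have Ix : I x by apply: abI; rewrite in_itv /= in xab.
  apply: cvg_trans (is_derive_in_continuous Ix (hf1 x Ix)).
  apply: cvg_app; apply: within_subset => y /=; rewrite in_itv /=; exact: abI.
have [F [cF dF FE]] := continuous_primitive hab cf.
set A := `|f3 a| `^ q; set B := `|f3 b| `^ q.
have A0 : 0 <= A by exact: powR_ge0.
have B0 : 0 <= B by exact: powR_ge0.
have q0 : 0 < q by lra.
pose m := (a + b) / 2.
have am : a < m by rewrite /m; lra.
have mb : m < b by rewrite /m; lra.
have cmp (al be : R) :
    (forall r s, 0 <= r -> 0 <= s ->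
      (r * A + s * B) `^ (1 / q) <= al * (r * A + s * B) + be) ->
    forall x y, a < x -> x <= y -> y < b -> `|f2 y - f2 x| <=
      (al * B * (b - a) * ln (y - a) - al * A * (b - a) * ln (b - y) + be * y) -
      (al * B * (b - a) * ln (x - a) - al * A * (b - a) * ln (b - x) + be * x).
  move=> tan.
  pose H x := al * B * (b - a) * ln (x - a) -
    al * A * (b - a) * ln (b - x) + be * x.
  pose h x := al * ((b - a) / (b - x) * A + (b - a) / (x - a) * B) + be.
  apply: (@absolutely_continuous_increment_le _ f2 H f3 h a b acf2 _ df2) => x xab.
    have xa0 : 0 < 1 * x + - a by lra.
    have bx0 : 0 < -1 * x + b by lra.
    apply: (is_derive_ext (is_derive_add (is_derive_add
      (is_derive_scale (al * B * (b - a))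
        (is_derive_comp_affine (is_derive1_ln xa0)))
      (is_derive_scale (- (al * A * (b - a)))
        (is_derive_comp_affine (is_derive1_ln bx0))))
      (is_derive_affine x be 0))) => [y|].
      by rewrite /H !mul1r mulN1r addr0 mulNr (addrC (- y)).
    by rewrite /h; field; lra.
  have f3E : `|f3 x| = (`|f3 x| `^ q) `^ (1 / q).
    by rewrite -powRrM mulrCA divff ?mulr1 ?powRr1 ?gt_eqF.
  have r0 : 0 <= (b - a) / (b - x) by rewrite divr_ge0; lra.
  have s0 : 0 <= (b - a) / (x - a) by rewrite divr_ge0; lra.
  rewrite f3E (le_trans _ (tan _ _ r0 s0)) //.
  apply: ge0_ler_powR; rewrite ?nnegrE ?powR_ge0 //.
  - by rewrite divr_ge0 // ltW.
  - by apply: addr_ge0; exact: mulr_ge0.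
  - exact: (godunova_levin_le hQ ha hb xab).
have eN (g : R -> R) : (fun x => g (-1 * x + 0)) = (fun x => g (- x)).
  by apply/funext => x; rewrite mulN1r addr0.
have sub_l x : a < x <= m -> a < x < b by lra.
have sub_r x : - b < x <= - m -> a < - 1 * x + 0 < b by lra.
have left : `|F m - F a - (m - a) / 3 * (f a + 2 * f m) +
    (m - a) ^+ 2 / 6 * f1 m| <=
  (b - a) ^+ 4 / 6 * (1 / 192) `^ (1 - 1 / q) *
    ((17 / 48 - 1 / 2 * ln 2) * A + B / 48) `^ (1 / q).
  have sW : `[a, m] `<=` `[a, b] by apply: subset_itvl; rewrite bnd_simp ltW.
  apply: (@simpson_half_powR_le _ F f f1 f2) => //.
  - by move=> x /sub_l /dF.
  - by move=> x /sub_l /df.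
  - by move=> x /sub_l /df1.
  - exact: continuous_subspaceW sW cF.
  - exact: continuous_subspaceW sW cf.
  - by move=> al be tan x y ax xy ym; apply: cmp tan x y ax xy (le_lt_trans ym mb).
have right : `|F b - F m - (b - m) / 3 * (f b + 2 * f m) -
    (b - m) ^+ 2 / 6 * f1 m| <=
  (b - a) ^+ 4 / 6 * (1 / 192) `^ (1 - 1 / q) *
    (A / 48 + (17 / 48 - 1 / 2 * ln 2) * B) `^ (1 / q).
  have sW : `[m, b] `<=` `[a, b] by apply: subset_itvr; rewrite bnd_simp ltW.
  (* The right half is the left half after [x |-> - x], with [A] and [B] exchanged; the signs keep
     each function the derivative of the preceding one. *)
  have := @simpson_half_powR_le _ (fun x => -1 * F (-1 * x + 0))
    (fun x => f (-1 * x + 0))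
    (fun x => -1 * f1 (-1 * x + 0)) (fun x => -1 * (-1 * f2 (-1 * x + 0)))
    (- b) (- a) (- m) B A q.
  rewrite !mulN1r !addr0 !opprK.
  have -> : - a + b = b - a by rewrite addrC.
  have -> : - m + b = b - m by rewrite addrC.
  rewrite mulrN (addrC (- F m)) (addrC (_ * B)); apply=> //.
  - by rewrite ltrN2.
  - by rewrite /m; field.
  - move=> x /sub_r xab.
    by apply: (is_derive_ext (is_derive_scale (-1)
      (is_derive_comp_affine (dF _ xab)))) => //; ring.
  - move=> x /sub_r xab.
    exact: is_derive_comp_affine (df _ xab).
  - move=> x /sub_r xab.
    exact: is_derive_scale (is_derive_comp_affine (df1 _ xab)).
  - apply: within_continuous_mul; first exact: within_continuous_const.
    by rewrite eN; exact: within_continuous_opp mb (continuous_subspaceW sW cF).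
  - by rewrite eN; exact: within_continuous_opp mb (continuous_subspaceW sW cf).
  - move=> al be tan x y bx xy ym.
    have tan' r s : 0 <= r -> 0 <= s ->
      (r * A + s * B) `^ (1 / q) <= al * (r * A + s * B) + be.
      by move=> r0 s0; rewrite addrC tan.
    have := cmp al be tan' (- y) (- x).
    rewrite !mulN1r !addr0 !opprK distrC => hh.
    have {}hh := hh ltac:(lra) ltac:(lra) ltac:(lra).
    apply: le_trans hh _.
    by rewrite ![- x - a]addrC ![- y - a]addrC ![b + _]addrC ![- a + b]addrC; lra.
rewrite FE [leRHS]mulrDr [leRHS]addrC.
(* The two terms in [f1 m] cancel because [m - a = b - m]. *)
rewrite (_ : F b - F a - _ =
  (F m - F a - (m - a) / 3 * (f a + 2 * f m) + (m - a) ^+ 2 / 6 * f1 m) +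
  (F b - F m - (b - m) / 3 * (f b + 2 * f m) - (b - m) ^+ 2 / 6 * f1 m)); last first.
  rewrite -/m; have bE : b = 2 * m - a by rewrite /m; field.
  move: (F m) (F a) (F b) (f a) (f b) (f m) (f1 m); clearbody m => *.
  by rewrite bE; field.
by rewrite (le_trans (ler_normD _ _)) // lerD.
Qed.
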